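(* Let $X$ be an alphabet (finite or infinite) and let $x$ be an infinite word on $X$. Then $x$ is eventually periodic if and only if for every finite colouring of $X^*$ there is a suffix of $x$ having a super-monochromatic factorisation.
   Context: $X^*$ denotes the set of all finite words over $X$. An infinite word is $x=x_1x_2x_3\cdots$ with each $x_i\in X$; a suffix of $x$ is an infinite word $x_nx_{n+1}\cdots$ for some $n\ge 1$. The word $x$ is eventually periodic if some suffix of $x$ equals $uuu\cdots$ for some non-empty finite word $u$. A factorisation of an infinite word $y$ is a sequence $u_1,u_2,\dots$ of non-empty finite words with $y=u_1u_2u_3\cdots$ (concatenation). Given a finite colouring of $X^*$, a factorisation $y=u_1u_2\cdots$ is super-monochromatic if all the words $u_{k_1}u_{k_2}\cdots u_{k_n}$, for all $n\ge1$ and all $k_1<k_2<\cdots<k_n$, have the same colour. *)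

(* Defs.v *)
From mathcomp Require Import all_boot.

Set Implicit Arguments.
Unset Strict Implicit.
Unset Printing Implicit Defensive.

(* Infinite words are indexed from 0: the letter x_n of x = x_1 x_2 ... is
   [x n.-1].  Finite words, the elements of X^*, are sequences [seq X]. *)
Definition infword (X : Type) := nat -> X.

Definition infsuffix (X : Type) (x : infword X) (n : nat) : infword X :=
  fun i => x (n + i).

(* y = u_0 u_1 u_2 ... with all u_i non-empty.  Since the lengths of the partial
   products are then unbounded, y is the infinite concatenation exactly when
   every partial product u_0 ... u_(n-1) is a prefix of y. *)
Definition factorisation (X : Type) (u : nat -> seq X) (y : infword X) : Prop :=
  (forall i, u i <> [::]) /\
  (forall n, let w := flatten (mkseq u n) in w = mkseq y (size w)).

(* Some suffix equals v v v ...; [factorisation] forces v to be non-empty. *)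
Definition eventually_periodic (X : Type) (x : infword X) : Prop :=
  exists (n : nat) (v : seq X), factorisation (fun _ => v) (infsuffix x n).

(* The list ks is k_1 < ... < k_n, with n >= 1. *)
Definition super_monochromatic (X C : Type) (c : seq X -> C)
    (u : nat -> seq X) : Prop :=
  exists a : C, forall ks : seq nat, ks <> [::] -> sorted ltn ks ->
    c (flatten [seq u k | k <- ks]) = a.

(* Main.v *)
(* If x ends in v v v ..., colour n by the colour of v^n: Hindman's theorem,
   proved with an idempotent ultrafilter on nat, gives exponents a_k all of whose
   finite sums have one colour, and u_k = v^(a_k) works.

   Conversely, let x be not eventually periodic, write p w for the position of
   the first occurrence of w in x, and suppose u_0 u_1 ... is a
   super-monochromatic factorisation of a suffix, u_k starting at position P k.
   Distinct suffixes of x differ, so u_k ... u_(n-1) first occurs at P k once n is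
   large, while its length is unbounded.  One colour class is "w is a factor of x
   and is very long compared to p w", with "very long" chosen so that two distinct
   occurrences of the long tail u_k ... u_(n-1) of w cannot both start near p w.
   Hence for i < j < k and n large the word u_i ... u_(j-1) u_k ... u_(n-1) is a
   factor whose tail sits at P k; it first occurs at P k - P j + P i, and ends at
   P n.  It remains to colour the pairs (s, e) so that (P i, P n), (P j, P n),
   (P k, P n) and (P k - P j + P i, P n) cannot always agree.  Count modulo 4 how
   often the comparison of s and e - s modulo 3^b changes with b.  If P i, P j,
   P k, P n are close enough 3-adically, then the pattern of P k - P j + P i is
   that of P i for small b, the negation of that of P j in a middle range, and that
   of P k for large b.  So its count is the sum of the three others; all counts
   are odd, and a + a + a differs from a modulo 4. *)
Require Import Defs.
From mathcomp Require Import all_boot boolp classical_sets filter.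
From mathcomp Require Import zify.

Set Implicit Arguments.
Unset Strict Implicit.
Unset Printing Implicit Defensive.

Local Open Scope classical_set_scope.

(** * An idempotent ultrafilter on the natural numbers *)

Definition shift (A : set nat) (n : nat) : set nat := [set m | A (n + m)].

Lemma shift_shift A n m : shift (shift A n) m = shift A (n + m).
Proof. by apply/funext => k; rewrite /shift /= addnA. Qed.

(** The clause on positive numbers is conditional so that the empty family qualifies, as the union
    of the empty chain must in Zorn's lemma. The last clause makes the ultrafilters containing [F]
    closed under addition. *)
Definition sum_filter (F : set (set nat)) : Prop :=
  [/\ ~ F set0,
      forall A B, F A -> F B -> F (A `&` B),
      forall A B, A `<=` B -> F A -> F B,
      forall A, F A -> F [set n | 0 < n] &
      forall A, F A -> F [set n | F (shift A n)]].

Lemma maximal_sum_filter :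
  exists F, [/\ sum_filter F, F [set n | 0 < n] &
    forall G, sum_filter G -> F `<=` G -> G = F].
Proof.
have [|F [sF maxF]] := @Zorn_bigcup _ [set F | sum_filter F].
  move=> Fs sFs tot; split.
  - by case=> F FsF F0; have [] := sFs _ FsF.
  - move=> A B [F FsF FA] [G FsG GB].
    have [FG|GF] := tot _ _ FsF FsG.
      by exists G => //; have [_ GI _ _ _] := sFs _ FsG; apply: GI => //; apply: FG.
    by exists F => //; have [_ FI _ _ _] := sFs _ FsF; apply: FI => //; apply: GF.
  - move=> A B AB [F FsF FA]; exists F => //.
    by have [_ _ FS _ _] := sFs _ FsF; apply: FS FA.
  - move=> A [F FsF FA]; exists F => //.
    by have [_ _ _ FP _] := sFs _ FsF; apply: FP FA.
  - move=> A [F FsF FA]; exists F => //.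
    have [_ _ FS _ FP] := sFs _ FsF; apply: (FS) (FP _ FA) => n /= FAn.
    by exists F.
have maxE G : sum_filter G -> F `<=` G -> G = F.
  by move=> sG FG; apply: contrapT => GF; apply: (maxF G) => //;
     rewrite properEneq; split=> //; apply/eqP => FGE; apply: GF.
exists F; split => //; apply: contrapT => nFpos.
have F0 : F = set0.
  by rewrite -subset0 => A FA; apply: nFpos; have [_ _ _ FP _] := sF; apply: FP FA.
(* The empty family is not maximal: the sets containing all positive numbers form a larger sum
   filter. *)
pose G : set (set nat) := [set A | forall n, 0 < n -> A n].
have GF : G = F.
  apply: maxE; last by rewrite F0.
  split.
  - by move=> /(_ 1 isT).
  - by move=> A B GA GB n n0; split; [apply: GA|apply: GB].
  - by move=> A B AB GA n /GA /AB.
  - by move=> A GA n.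
  - by move=> A GA n n0 m m0; apply: GA; rewrite addn_gt0 n0.
have : G setT by move=> ? ?.
by rewrite GF F0.
Qed.

(* The Ellis-Numakura argument: the ultrafilters containing a sum filter form a
   closed subsemigroup of the Stone-Cech compactification of nat; a maximal sum
   filter gives a minimal subsemigroup, which consists of one idempotent. *)
Lemma idempotent_ultrafilter :
  exists U : set (set nat), [/\ UltraFilter U, U [set n | 0 < n] &
    forall A, U A -> U [set n | U (shift A n)]].
Proof.
have [F [[F0 FI FS FP Fsh] Fpos maxF]] := maximal_sum_filter.
have FF : ProperFilter F.
  by split=> //; split=> //; apply: FS Fpos.
have [U [UU FU]] := ultraFilterLemma FF.
pose lift (A : set nat) : set nat := [set n | U (shift A n)].
have liftI A B : lift (A `&` B) = lift A `&` lift B.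
  apply/seteqP; split => [n /= Un|n [/= UA UB]]; last exact: filterI.
  by split; apply: filterS Un => m [].
have lift0 : lift set0 = set0.
  by rewrite -subset0 => n /filter_ex [].
have liftS A B : A `<=` B -> lift A `<=` lift B.
  by move=> AB n; apply: filterS => m; apply: AB.
have shift_lift A n : lift (shift A n) = shift (lift A) n.
  by apply/funext => m; rewrite /lift /mkset shift_shift.
(* The left side is the filter of all sums V + [U], with V an ultrafilter containing [F]. It is a
   sum filter above [F], so maximality applies. *)
have liftF : [set A | F (lift A)] = F.
  apply: maxF; last first.
    by move=> A FA; apply: (FS) (Fsh _ FA) => n FAn; apply: FU.
  split => /=.
  - by rewrite lift0.
  - by move=> A B; rewrite liftI; apply: FI.
  - by move=> A B AB; apply: FS; apply: liftS.
  - move=> _ _; apply: (FS) (Fpos) => n n0.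
    by apply: filterS (FU _ Fpos) => m; rewrite /shift /= => _; rewrite addn_gt0 n0.
  - move=> A FA; apply: (FS) (Fsh _ FA) => n FAn /=; apply: FU.
    by apply: (FS) (Fsh _ FAn) => m; rewrite /= shift_shift -shift_lift.
(* [H] is the filter of those ultrafilters V containing [F] with V + [U] = [U]. Once [H = F], every
   [A] in [U] has [lift A] in [F], hence in [U]. *)
pose H : set (set nat) := [set C | exists A B, [/\ U A, F B & B `&` lift A `<=` C]].
have HF : H = F.
  apply: maxF; last first.
    by move=> B FB; exists setT, B; split => //; exact: filterT.
  split.
  - move=> [A [B [UA FB BA]]].
    have : F (lift (~` A)).
      apply: (FS) FB => n Bn; have [//|UAn] := in_ultra_setVsetC (shift A n) UU.
        by move=> UAn; case: (BA n).
      exact: UAn.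
    rewrite -[F (lift _)]/([set A | F (lift A)] _) liftF => /FU UCA.
    by have [n []] := filter_ex (filterI UA UCA).
  - move=> C C' [A [B [UA FB BA]]] [A' [B' [UA' FB' BA']]].
    exists (A `&` A'), (B `&` B'); split; [exact: filterI|exact: FI|].
    by rewrite liftI => n [[Bn B'n] [An A'n]]; split; [apply: BA|apply: BA'].
  - move=> C D CD [A [B [UA FB BA]]]; exists A, B; split => //.
    by move=> n /BA /CD.
  - move=> _ _; exists setT, [set n | 0 < n]; split => //.
    exact: filterT.
  - move=> C [A [B [UA FB BA]]].
    exists A, (B `&` [set n | F (shift B n)]); split => //.
      by apply: FI => //; apply: Fsh.
    move=> n [[Bn FBn] An]; exists (shift A n), (shift B n); split => //.
    by rewrite shift_lift => m [Bnm Anm]; apply: BA.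
exists U; split => //; first exact: FU.
move=> A UA; apply: FU; rewrite -HF.
by exists A, [set n | 0 < n]; split => // n [].
Qed.

(** * Hindman's theorem *)

Lemma ultra_pigeonhole (U : set (set nat)) r (c : nat -> 'I_r) :
  UltraFilter U -> exists i, U [set n | c n = i].
Proof.
move=> UU; apply: contrapT => /forallNP nU.
suff : U [set n | forall i, i \in enum 'I_r -> c n <> i].
  by move=> /filter_ex[n /(_ (c n))]; rewrite mem_enum => /(_ isT).
elim: (enum 'I_r) => [|j s IH]; first by apply: filterS filterT.
have [/nU//|Uj] := in_ultra_setVsetC [set n | c n = j] UU.
apply: filterS (filterI Uj IH) => n [/= nj ns] l.
by rewrite inE => /orP[/eqP -> //|]; exact: ns.
Qed.

(** The sets [As k] decrease inside one colour class and belong to the idempotent ultrafilter; [a k]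
    lies in [As k] and translates [As k.+1] into [As k]. Adding the terms of a sum from the last to
    the first thus never leaves the class. *)
Lemma hindman r (c : nat -> 'I_r) :
  exists (a : nat -> nat) (i : 'I_r), (forall k, 0 < a k) /\
    forall ks, ks <> [::] -> sorted ltn ks -> c (\sum_(k <- ks) a k) = i.
Proof.
have [U [UU Upos Uid]] := idempotent_ultrafilter.
have [i Ui] := ultra_pigeonhole c UU.
have /choice[f fP] : forall A, exists n, U A -> [/\ A n, U (shift A n) & 0 < n].
  move=> A; have [UA|?] := EM (U A); last by exists 0.
  by have [n [[? ?] ?]] := filter_ex (filterI (filterI UA (Uid _ UA)) Upos); exists n.
pose As := fun n => iter n (fun A => A `&` shift A (f A)) [set n | c n = i].
have UAs n : U (As n) by elim: n => //= n IH; apply: filterI => //; have [] := fP _ IH.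
have AsS m n : m <= n -> As n `<=` As m.
  by move=> /subnK <-; elim: (n - m) => // d IH t [/IH].
pose a n := f (As n); exists a, i; split => [k|ks]; first by have [] := fP _ (UAs k).
suff key k s : path ltn k s -> As k (\sum_(j <- k :: s) a j).
  by case: ks => // k s _ /key; apply: (AsS 0).
elim: s k => [|l s IH] k /=.
  by move=> _; rewrite big_seq1; have [] := fP _ (UAs k).
by case/andP => kl /IH Asl; rewrite big_cons; have [] := AsS _ _ kl _ Asl.
Qed.

Local Close Scope classical_set_scope.

(** * Comparison patterns modulo powers of 3 *)

(* In the second alternative the multiples of [m] in [y] and [z] are opposite
   modulo [t * m]; since [t] is odd they are distinct unless both vanish.  With
   [t] even, as powers of 2 would give, both could be half the modulus. *)
Lemma ltn_mod_shift m t h y z :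
    h.*2 < m -> 0 < t -> m %| z -> h <= y ->
    h.*2 < y %% m \/ [/\ y %% m < h, odd t & (y + z) %% (t * m) = y %% m] ->
  ((y - h) %% (t * m) < (z + h) %% (t * m)) = (y %% (t * m) < z %% (t * m)) /\
  ((z + h) %% (t * m) < (y - h) %% (t * m)) = ~~ (y %% (t * m) < z %% (t * m)).
Proof.
move=> hm t0 /dvdnP[z' ->] hy; set r := y %% m => cases.
have m0 : 0 < m by apply: leq_ltn_trans hm.
have rm : r < m by rewrite ltn_mod.
have [l lt zE] : exists2 l, l < t & (z' * m) %% (t * m) = m * l.
  by exists (z' %% t); rewrite ?ltn_mod // -muln_modl mulnC.
have [k [q [kt yE]]] : exists k q, k < t /\ y = q * (t * m) + (r + m * k).
  exists ((y %/ m) %% t), ((y %/ m) %/ t); rewrite ltn_mod t0; split=> //.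
  by rewrite {1}(divn_eq y m) {1}(divn_eq (y %/ m) t) -/r; lia.
have kM : m * k + m <= t * m by rewrite -mulnSr mulnC leq_mul2r kt orbT.
have lM : m * l + m <= t * m by rewrite -mulnSr mulnC leq_mul2r lt orbT.
have yM : y %% (t * m) = r + m * k by rewrite yE modnMDl modn_small //; lia.
have zhM : (z' * m + h) %% (t * m) = m * l + h.
  by rewrite -modnDml zE modn_small //; lia.
have cmp : [\/ k = l, m * k + m <= m * l | m * l + m <= m * k].
  case: (ltngtP k l) => kl; [apply: Or32|apply: Or33|exact: Or31];
    by rewrite -mulnSr leq_mul2l kl orbT.
have small : h <= r + m * k -> (y - h) %% (t * m) = r + m * k - h.
  by move=> hk; rewrite yE -addnBA // modnMDl modn_small //; lia.
rewrite zhM yM zE.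
case: cases => [hr|[rh ot yz]].
  rewrite small; last by clear -hr; lia.
  case: cmp => [->|H|H]; first by clear -hr; lia.
    by clear -hm hr rm H; lia.
  by clear -hm hr rm H; lia.
have kl : k = l -> k = 0.
  move=> kl; have : (r + (k + k) * m) %% (t * m) = r.
    by move: yz; rewrite -modnDml yM -modnDmr zE -kl mulnDl [k * m]mulnC addnA.
  clear -kt m0 rm ot => yz.
  have [kkt|kkt] := ltnP (k + k) t.
    have H : (k + k) * m + m <= t * m by rewrite -mulSnr leq_mul2r kkt orbT.
    move: yz; rewrite modn_small; last by clear -H rm; lia.
    by move/eqP; rewrite -{2}[r]addn0 eqn_add2l muln_eq0; clear -m0; lia.
  have [kk|kk] := eqVneq (k + k) t; first by move: ot; rewrite -kk addnn odd_double.
  have E : r + (k + k) * m = 1 * (t * m) + (r + (k + k - t) * m).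
    by rewrite mul1n addnCA -mulnDl subnKC.
  have H : (k + k - t) * m + m <= t * m.
    by rewrite -mulSnr leq_mul2r; apply/orP; right; clear -kt; lia.
  move: yz; rewrite E modnMDl modn_small; last by clear -H rm; lia.
  move/eqP; rewrite -{2}[r]addn0 eqn_add2l muln_eq0; clear -m0 kkt kk; lia.
have [k0|k0] := eqVneq k 0; last first.
  have mk : m <= m * k by rewrite leq_pmulr // lt0n.
  rewrite small; last by clear -mk hm; lia.
  case: cmp => H; first by case/eqP: k0; exact: kl.
    by clear -hm rh mk H; lia.
  by clear -hm rh mk H; lia.
(* Here [y - h] drops below a multiple of [t * m], so its residue wraps around to [t * m + r - h].
   Since [l] vanishes too, the comparison keeps its outcome. *)
subst k; have q0 : 0 < q by case: (q) yE => // yE; clear -yE rh hy; lia.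
have -> : (y - h) %% (t * m) = t * m + r - h.
  have -> : y - h = q.-1 * (t * m) + (t * m + r - h).
    rewrite yE muln0 addn0 -{1}(prednK q0) mulSnr -addnA addnBA //.
    by clear -kM hm; lia.
  by rewrite modnMDl modn_small //; clear -kM hm rh; lia.
have l0 : l = 0.
  have : (r + m * l) %% (t * m) = r.
    by move: yz; rewrite -modnDml yM -modnDmr zE muln0 addn0.
  rewrite modn_small; last by clear -lM rm; lia.
  by move/eqP; rewrite -{2}[r]addn0 eqn_add2l muln_eq0; clear -m0; lia.
by subst l; clear -hm kM; lia.
Qed.

Definition below (e s b : nat) : bool := s %% 3 ^ b < (e - s) %% 3 ^ b.

Definition changes (f : nat -> bool) (n : nat) : nat :=
  \sum_(b < n) (f b != f b.+1).

Lemma odd_changes f n : odd (changes f n) = f 0 (+) f n.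
Proof.
rewrite /changes; elim: n => [|n IH]; first by rewrite big_ord0 addbb.
by rewrite big_ord_recr oddD IH /= oddb; case: (f 0) (f n) (f n.+1) => [] [] [].
Qed.

(** In each of the three ranges only one of [fA], [fB], [fC] varies, and negation preserves changes.
    The ranges share their endpoints [d1] and [d2], so no change is lost or created at a
    junction. *)
Lemma changes_glue (f fA fB fC : nat -> bool) (d1 d2 n : nat) :
    d1 <= d2 ->
    (forall b, b <= d1 -> f b = fA b) ->
    (forall b, d1 <= b <= d2 -> f b = ~~ fB b) ->
    (forall b, d2 <= b -> f b = fC b) ->
    (forall b, d1 <= b -> fA b) ->
    (forall b, b <= d1 -> fB b = false) -> (forall b, d2 <= b -> fB b) ->
    (forall b, b <= d2 -> fC b = false) ->
  changes f n = changes fA n + changes fB n + changes fC n.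
Proof.
move=> d12 fEA fEB fEC hA hB hB' hC; rewrite /changes -!big_split /=.
apply: eq_bigr => b _; have [bd1|d1b] := ltnP b d1.
  have bd1' := ltnW bd1; have bd2 := leq_trans bd1' d12.
  by rewrite !fEA // !hB // !hC ?(leq_trans bd1) // !addn0.
have d1b' := leqW d1b; rewrite !hA //=; have [bd2|d2b] := ltnP b d2.
  have bd2' := ltnW bd2; rewrite !fEB ?d1b ?d1b' // !hC //=.
  by rewrite addn0; case: (fB b) (fB b.+1) => [] [].
by have d2b' := leqW d2b; rewrite !fEC // !hB'.
Qed.

Lemma below_eqmod e s b : s <= e -> e = s %[mod 3 ^ b] -> below e s b = false.
Proof.
by move=> se /eqP; rewrite eqn_mod_dvd // /below => /eqP ->; rewrite ltn0.
Qed.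

(** Modulo [3 ^ b] the number [s] is its own residue. That of [e - s] is [e %% 3 ^ b - s], increased
    by [3 ^ b] in the second case; both exceed [s]. *)
Lemma below_small e s b : s <= e ->
    s.*2 < e %% 3 ^ b \/ e %% 3 ^ b < s /\ s.*2 < 3 ^ b -> below e s b.
Proof.
rewrite /below; set M := 3 ^ b => se cases.
have gM : e %% M < M by rewrite ltn_mod expn_gt0.
have sM : s < M by case: cases => [|[]]; move: gM; clear; lia.
rewrite [s %% M]modn_small // {1}(divn_eq e M).
case: cases => [c|[gs c]].
  rewrite -addnBA; last by clear -c; lia.
  by rewrite modnMDl modn_small; clear -c gM; lia.
have q0 : 0 < e %/ M.
  by rewrite divn_gt0 ?expn_gt0 // leqNgt; apply/negP => eM;
     move: gs; rewrite modn_small // ltnNge se.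
rewrite -(prednK q0) mulSnr -addnA -addnBA; last by clear -c; lia.
by rewrite modnMDl modn_small; clear -c gM gs; lia.
Qed.

Lemma increasing_ge (P : nat -> nat) n : (forall k, P k < P k.+1) -> n <= P n.
Proof. by move=> Plt; elim: n => // n IH; apply: leq_ltn_trans (Plt n). Qed.

Lemma increasing_leq (P : nat -> nat) m n :
  (forall k, P k < P k.+1) -> m <= n -> P m <= P n.
Proof.
move=> Plt /subnK <-; elim: (n - m) => // d IH.
exact: leq_trans IH (ltnW (Plt _)).
Qed.

(* The two cases are those of a 3-adic limit of the positions which is not, or
   which is, a natural number. *)
Lemma below_alternating A B C E d1 d2 :
    A <= B -> B <= C -> C <= E -> d1 <= d2 ->
    B = E %[mod 3 ^ d1] -> C = E %[mod 3 ^ d2] ->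
    A.*2 < E %% 3 ^ d1 /\ B.*2 < E %% 3 ^ d2 \/
    (exists d3, [/\ d2 <= d3, E %% 3 ^ d3 < A,
      [/\ A.*2 < 3 ^ d1, B.*2 < 3 ^ d2 & C.*2 < 3 ^ d3] & A.*2 < B]) ->
  let f s := below E s in
  [/\ forall b, b <= d1 -> f (C - B + A) b = f A b,
      forall b, d1 <= b <= d2 -> f (C - B + A) b = ~~ f B b,
      forall b, d2 <= b -> f (C - B + A) b = f C b,
      forall b, d1 <= b -> f A b &
      [/\ forall b, b <= d1 -> f B b = false, forall b, d2 <= b -> f B b &
      forall b, b <= d2 -> f C b = false]].
Proof.
move=> AB BC CE d12 BE CE2 cases f.
have weak a b x y : a <= b -> x = y %[mod 3 ^ b] -> x = y %[mod 3 ^ a].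
  by move=> ab xy; rewrite -(modn_dvdm x (dvdn_exp2l 3 ab)) xy modn_dvdm // dvdn_exp2l.
have geM a b x : a <= b -> x %% 3 ^ a <= x %% 3 ^ b.
  by move=> ab; rewrite -(modn_dvdm x (dvdn_exp2l 3 ab)) leq_mod.
have ge3 a b : a <= b -> 3 ^ a <= 3 ^ b by move=> ab; rewrite leq_exp2l.
have CE1 : C = E %[mod 3 ^ d1] by apply: weak CE2.
have dCB b : b <= d1 -> C - B = 0 %[mod 3 ^ b].
  move=> bd; apply/eqP; rewrite mod0n -/(dvdn _ _) -eqn_mod_dvd //; apply/eqP.
  by apply: weak bd _; rewrite BE.
have dEC b : b <= d2 -> E - C = 0 %[mod 3 ^ b].
  move=> bd; apply/eqP; rewrite mod0n -/(dvdn _ _) -eqn_mod_dvd //; apply/eqP.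
  by apply: weak bd _; rewrite CE2.
have sub1 : E - (C - B + A) = (E - C) + (B - A) by clear -AB BC CE; lia.
have sub2 : C - B + A = C - (B - A) by clear -AB BC CE; lia.
have small y b d : y <= C -> d <= b -> y.*2 < E %% 3 ^ d -> f y b.
  move=> yC db h; apply: below_small; first exact: leq_trans CE.
  by left; apply: leq_trans h (geM _ _ _ db).
have odd_t a b : odd (3 ^ (b - a)) by rewrite oddX orbT.
have tE a b : a <= b -> 3 ^ b = 3 ^ (b - a) * 3 ^ a by move=> ab; rewrite -expnD subnK.
have f1 b : b <= d1 -> f (C - B + A) b = f A b.
  move=> bd; rewrite /f /below sub1.
  have -> : (C - B + A) %% 3 ^ b = A %% 3 ^ b by rewrite -modnDml dCB // mod0n.
  have -> : E - A = (E - C) + ((C - B) + (B - A)) by clear -AB BC CE; lia.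
  by rewrite -[in RHS]modnDmr -[in RHS](modnDml (C - B)) dCB // mod0n modnDmr.
(* Here [ltn_mod_shift] is used with [h = A], [y = B], [z = C - B]. The start [C - B + A] is
   [z + h], on the side opposite to [B], whence the negation. *)
have f2 b : d1 <= b <= d2 ->
  A.*2 < 3 ^ d1 ->
  A.*2 < B %% 3 ^ d1 \/ B %% 3 ^ d1 < A /\ E %% 3 ^ b = B %% 3 ^ d1 ->
  f (C - B + A) b = ~~ f B b.
  move=> /andP[b1 b2] hm c; rewrite /f /below sub1.
  rewrite -[(E - C + _) %% _]modnDml dEC // mod0n.
  have -> : E - B = (E - C) + (C - B) by clear -BC CE; lia.
  rewrite -[(E - C + _) %% _]modnDml dEC // mod0n !add0n (tE d1 b) //.
  apply: (proj2 (ltn_mod_shift hm _ _ AB _)); rewrite ?expn_gt0 //.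
    by rewrite /dvdn dCB // mod0n.
  case: c => [?|[c1 c2]]; [by left|right; split; rewrite ?odd_t //].
  by rewrite -tE // addnC subnK // (weak _ _ _ _ b2 CE2).
(* Now [h = B - A], [y = C], [z = E - C]: start and length keep their sides. *)
have f3 b : d2 <= b -> (B - A).*2 < 3 ^ d2 ->
    (B - A).*2 < C %% 3 ^ d2 \/ C %% 3 ^ d2 < B - A /\ E %% 3 ^ b = C %% 3 ^ d2 ->
    f (C - B + A) b = f C b.
  move=> db hm c; rewrite /f /below sub1 sub2 (tE d2 b) //.
  apply: (proj1 (ltn_mod_shift hm _ _ _ _)); rewrite ?expn_gt0 //.
  - by rewrite /dvdn dEC // mod0n.
  - by apply: leq_trans BC; apply: leq_subr.
  case: c => [?|[c1 c2]]; [by left|right; split; rewrite ?odd_t //].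
  by rewrite -tE // subnKC.
have fB b : b <= d1 -> f B b = false.
  by move=> bd; apply: below_eqmod (leq_trans BC CE) _; apply: weak bd _.
have fC b : b <= d2 -> f C b = false.
  by move=> bd; apply: below_eqmod CE _; apply: weak bd _.
have AC := leq_trans AB BC.
case: cases => [[c1 c2]|[d3 [d23 xA [Ad Bd Cd] AB2]]].
  have Ad : A.*2 < 3 ^ d1 by apply: ltn_trans c1 _; rewrite ltn_mod expn_gt0.
  have H : (B - A).*2 <= B.*2 by rewrite leq_double leq_subr.
  have Bd : B.*2 < 3 ^ d2 by apply: ltn_trans c2 _; rewrite ltn_mod expn_gt0.
  split=> // [b bd|b bd|b bd|]; first by apply: f2 => //; left; rewrite BE.
  - by apply: f3 => //; [exact: leq_ltn_trans Bd|left; rewrite CE2; exact: leq_ltn_trans c2].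
  - exact: small c1.
  - by split=> // b bd; apply: small c2.
(* As [x < A < 3 ^ d1], the base 3 digits of [E] from [d1] up to [d3] vanish. *)
set x := E %% 3 ^ d3 in xA.
have xd b : d1 <= b <= d3 -> E %% 3 ^ b = x.
  move=> /andP[b1 b2]; rewrite -(modn_dvdm E (dvdn_exp2l 3 b2)) modn_small //.
  by apply: leq_trans (ge3 _ _ b1); apply: ltn_trans xA _; clear -Ad; lia.
have large y b d : d1 <= d <= d3 -> d <= b -> A <= y <= C -> y.*2 < 3 ^ d -> f y b.
  move=> /andP[dd1 dd3] db /andP[Ay yC] yd; apply: below_small; first exact: leq_trans CE.
  have [bd3|bd3] := leqP b d3.
    rewrite xd ?bd3 ?(leq_trans dd1) //; right; split; first exact: leq_trans xA _.
    by apply: leq_trans yd (ge3 _ _ db).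
  (* Beyond [d3] the residue of [E] is still [x], or has a nonzero higher digit and so is at least
     [3 ^ d3]. *)
  have [Eb|Eb] := ltnP (E %% 3 ^ b) (3 ^ d3); last first.
    by left; apply: leq_trans Eb; apply: leq_trans yd (ge3 _ _ dd3).
  right; split; last by apply: leq_trans yd (ge3 _ _ db).
  rewrite -(modn_small Eb) (modn_dvdm E (dvdn_exp2l 3 (ltnW bd3))).
  exact: leq_trans xA _.
have d13 := leq_trans d12 d23.
split=> // [b bd|b bd|b bd|].
- apply: f2 => //; right; rewrite BE !xd ?leqnn ?d13 //.
  by case/andP: bd => -> bd2; rewrite (leq_trans bd2).
- have [bd3|bd3] := leqP b d3.
    apply: f3 => //; first by apply: leq_ltn_trans Bd; rewrite leq_double leq_subr.
    right; rewrite CE2 !xd ?d12 ?d23 ?bd3 ?(leq_trans d12) //; split=> //.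
    by clear -xA AB2; lia.
  rewrite !(large _ b d3) ?d13 ?leqnn ?AC ?leq_addl ?(ltnW bd3) //; first by rewrite sub2 leq_subr.
  by apply: leq_ltn_trans Cd; rewrite leq_double sub2 leq_subr.
- by apply: large Ad; rewrite ?leqnn ?d13 ?AC.
- by split=> // b bd; apply: large Bd; rewrite ?d12 ?d23 ?AB.
Qed.

(** * Positions close to a 3-adic limit point *)

(* [r] is a limit point of [P] in the 3-adic integers. *)
Lemma limit_residues (P : nat -> nat) :
  exists r : nat -> nat,
    (forall b b', b <= b' -> r b' %% 3 ^ b = r b) /\
    (forall b N, exists n, N <= n /\ P n = r b %[mod 3 ^ b]).
Proof.
have [U [UU Uoo]] := ultraFilterLemma eventually_filter.
have Ularge N : U [set n | N <= n]%classic by apply: Uoo; exists N.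
have /choice[r rP] : forall b, exists r, U [set n | P n %% 3 ^ b = r]%classic.
  move=> b; have b0 n : P n %% 3 ^ b < 3 ^ b by rewrite ltn_mod expn_gt0.
  have [i Ui] := ultra_pigeonhole (fun n => Ordinal (b0 n)) UU.
  by exists i; apply: filterS Ui => n /= <-.
have coherent b b' : b <= b' -> r b' %% 3 ^ b = r b.
  move=> bb'; have [n [/= <- <-]] := filter_ex (filterI (rP b) (rP b')).
  by rewrite modn_dvdm // dvdn_exp2l.
exists r; split=> // b N.
have [n [/= nr Nn]] := filter_ex (filterI (rP b) (Ularge N)).
by exists n; split=> //; rewrite nr coherent.
Qed.

(** The choices are made in the order [i], [d1], [j], [d2], [k], [n]: each exponent is large for the
    positions already fixed, and each later position agrees with the limit [r] modulo the power just
    chosen. *)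
Lemma alternating_selection (P : nat -> nat) : (forall n, P n < P n.+1) ->
  exists i j k, [/\ i < j, j < k & forall N, exists n d1 d2, [/\ N <= n, d1 <= d2,
    P j = P n %[mod 3 ^ d1], P k = P n %[mod 3 ^ d2] &
    (P i).*2 < P n %% 3 ^ d1 /\ (P j).*2 < P n %% 3 ^ d2 \/
    (exists d3, [/\ d2 <= d3, P n %% 3 ^ d3 < P i,
      [/\ (P i).*2 < 3 ^ d1, (P j).*2 < 3 ^ d2 & (P k).*2 < 3 ^ d3] &
      (P i).*2 < P j])]].
Proof.
move=> Plt; have Pge n := increasing_ge n Plt.
have [r [rE rP]] := limit_residues P.
have rr b : r b %% 3 ^ b = r b by apply: rE.
have rmono b b' : b <= b' -> r b <= r b' by move=> /rE <-; exact: leq_mod.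
have Pr b b' n : b <= b' -> P n = r b' %[mod 3 ^ b'] -> P n %% 3 ^ b = r b.
  by move=> bb' H; rewrite -(modn_dvdm _ (dvdn_exp2l 3 bb')) H rr rE.
have [unb|/existsNP[h hP]] := EM (forall h, exists b, h < r b).
  have [d1 rd1] := unb (P 0).*2.
  have [j [j0 jr]] := rP d1 1; have [d rd] := unb (P j).*2.
  pose d2 := maxn d1 d; have d12 : d1 <= d2 by exact: leq_maxl.
  have [k [jk kr]] := rP d2 j.+1.
  exists 0, j, k; split=> // N; have [n [Nn nr]] := rP d2 N.
  exists n, d1, d2; rewrite (Pr _ _ _ d12 nr) (Pr _ _ _ (leqnn d2) nr).
  rewrite (Pr _ _ _ (leqnn d2) kr) (Pr _ _ _ (leqnn d1) jr).
  split=> //; left; split=> //; apply: leq_trans rd _.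
  by apply: rmono; exact: leq_maxr.
have {}hP b : r b <= h by rewrite leqNgt; apply/negP => hb; apply: hP; exists b.
have ge3 n b : n <= b -> n < 3 ^ b by move=> nb; apply: leq_ltn_trans nb (ltn_expl _ _).
(* This puts [P i] above all residues [r b]. The exponent [(P i).*2] suffices because
   [m < 3 ^ m]. *)
pose i := h.+1; pose d1 := (P i).*2.
have [j [ij jr]] := rP d1 (maxn i (P i).*2).+1.
pose d2 := maxn d1 (P j).*2; have [k [jk kr]] := rP d2 j.+1.
pose d3 := maxn d2 (P k).*2.
have d12 : d1 <= d2 by exact: leq_maxl.
have d23 : d2 <= d3 by exact: leq_maxl.
exists i, j, k; split=> // [|N]; first by apply: leq_ltn_trans ij; exact: leq_maxl.
have [n [Nn nr]] := rP d3 N; exists n, d1, d2.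
rewrite (Pr _ _ _ d23 nr) (Pr _ _ _ (leq_trans d12 d23) nr).
rewrite (Pr _ _ _ (leqnn d2) kr) (Pr _ _ _ (leqnn d1) jr).
split=> //; right; exists d3; rewrite (Pr _ _ _ (leqnn d3) nr); split=> //.
- by apply: leq_ltn_trans (hP _) (leq_trans _ (Pge _)).
- by split; apply: ge3 => //; exact: leq_maxr.
- by apply: leq_trans (Pge j); apply: leq_ltn_trans ij; exact: leq_maxr.
Qed.

Lemma no_monochromatic_alternating_sums (P : nat -> nat) (a : nat) :
    (forall n, P n < P n.+1) ->
    (forall i, exists N, forall n, N <= n ->
      changes (below (P n) (P i)) (P n) = a %[mod 4]) ->
    (forall i j k, i < j -> j < k -> exists N, forall n, N <= n ->
      changes (below (P n) (P k - P j + P i)) (P n) = a %[mod 4]) ->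
  False.
Proof.
move=> Plt P1 P3.
have Pge n := increasing_ge n Plt.
have Ple m n := @increasing_leq P m n Plt.
have [i [j [k [ij jk sel]]]] := alternating_selection Plt.
have [Ni iP] := P1 i; have [Nj jP] := P1 j; have [Nk kP] := P1 k.
have [N3 tP] := P3 _ _ _ ij jk.
have [n [d1 [d2 [Nn d12 jn kn cases]]]] := sel (Ni + Nj + Nk + N3 + k + (P k).*2.+1).
have Pij := Ple _ _ (ltnW ij); have Pjk := Ple _ _ (ltnW jk).
have kn2 : (P k).*2 < P n by apply: leq_trans (Pge n); clear -Nn; lia.
have Pkn : P k <= P n by clear -kn2; lia.
have [f1 f2 f3 f4 [f5 f6 f7]] := below_alternating Pij Pjk Pkn d12 jn kn cases.
have := changes_glue (P n) d12 f1 f2 f3 f4 f5 f6 f7.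
(* The pattern is false at [b = 0], where both residues vanish, and true at [b = P n], where nothing
   is reduced and [s] is less than half of [P n]. *)
have odd_ch s : s <= P k -> odd (changes (below (P n) s) (P n)).
  move=> sk; rewrite odd_changes {1}/below !modn1 /= below_small //.
    exact: leq_trans sk Pkn.
  left; rewrite modn_small; last exact: ltn_expl.
  by apply: leq_ltn_trans kn2; rewrite leq_double.
have := odd_ch _ (leqnn _).
have := tP n; have := iP n; have := jP n; have := kP n.
have -> : Ni <= n by clear -Nn; lia.
have -> : Nj <= n by clear -Nn; lia.
have -> : Nk <= n by clear -Nn; lia.
have -> : N3 <= n by clear -Nn; lia.
move=> /(_ isT) + /(_ isT) + /(_ isT) + /(_ isT).
move: (changes _ _) (changes _ _) (changes _ _) (changes _ _) => x1 x2 x3 x4.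
by clear; lia.
Qed.

(** * Factors and suffixes of an infinite word *)

Definition factor (X : Type) (x : infword X) (s l : nat) : seq X :=
  mkseq (infsuffix x s) l.

Lemma factor_cat (X : Type) (x : infword X) s l m :
  factor x s (l + m) = factor x s l ++ factor x (s + l) m.
Proof.
rewrite /factor /mkseq iotaD map_cat -[in iota (0 + l)](addn0 l) add0n iotaDl -map_comp.
by congr (_ ++ _); apply: eq_map => i; rewrite /infsuffix /= addnA.
Qed.

Lemma factor_inj (X : Type) (x : infword X) a b l i :
  i < l -> factor x a l = factor x b l -> x (a + i) = x (b + i).
Proof.
by move=> il /(congr1 (fun w => nth (x 0) w i)); rewrite !nth_mkseq.
Qed.

Lemma eventually_periodic_shift (X : Type) (x : infword X) a b :
  a < b -> (forall i, x (a + i) = x (b + i)) -> eventually_periodic x.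
Proof.
move=> ab xE; pose d := b - a.
have xd i n : x (a + n * d + i) = x (a + i).
  elim: n => [|n <-]; first by rewrite addn0.
  have -> : a + n.+1 * d + i = b + (n * d + i).
    by rewrite mulSn !addnA subnKC // ltnW.
  by rewrite -xE addnA.
exists a, (factor x a d); split=> [_ /(congr1 size)|n /=].
  by rewrite size_mkseq /d /=; lia.
suff -> : flatten (mkseq (fun=> factor x a d) n) = factor x a (n * d) by rewrite size_mkseq.
elim: n => // n IH; rewrite mkseqS flatten_rcons IH mulSnr factor_cat.
by congr (_ ++ _); apply: eq_map => i; rewrite /infsuffix xd.
Qed.

Lemma suffix_separation (X : Type) (x : infword X) :
  ~ eventually_periodic x ->
  exists H : nat -> nat, forall Q a b m, a <= Q -> b <= Q -> H Q <= m ->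
    factor x a m = factor x b m -> a = b.
Proof.
move=> nper.
have sep a b : exists h, a <> b -> x (a + h) <> x (b + h).
  apply: contrapT => /forallNP nsep; apply: nper.
  have eqx i : x (a + i) = x (b + i).
    by apply: contrapT => ne; apply: (nsep i).
  have neq : a <> b by move=> ab; apply: (nsep 0) => /(_ ab).
  case: (ltngtP a b) => // [ab|ba]; first exact: eventually_periodic_shift ab eqx.
  by apply: eventually_periodic_shift ba _.
have /choice[h hP] : forall p : nat * nat, exists h, p.1 <> p.2 -> x (p.1 + h) <> x (p.2 + h).
  by case=> a b; exact: sep.
(* The double sum is simply a bound exceeding [h (a, b)] for all [a, b <= Q]. *)
exists (fun Q => \sum_(a < Q.+1) \sum_(b < Q.+1) (h (nat_of_ord a, nat_of_ord b)).+1) => Q a b m.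
rewrite -ltnS => aQ; rewrite -ltnS => bQ Hm eqab; apply: contrapT => neq.
apply: (hP (a, b) neq); apply: factor_inj eqab; apply: leq_trans Hm.
rewrite (bigD1 (Ordinal aQ)) //= (bigD1 (Ordinal bQ)) //= -addnA.
exact: leq_addr.
Qed.

Lemma first_occurrence (X : Type) (x : infword X) :
  exists p : seq X -> nat, forall w s, w = factor x s (size w) ->
    w = factor x (p w) (size w) /\ p w <= s.
Proof.
suff : forall w, exists p, forall s, w = factor x s (size w) ->
    w = factor x p (size w) /\ p <= s by move=> /choice[p pP]; exists p.
move=> w; have [ex|nex] := EM (exists s, `[< w = factor x s (size w) >]).
  case: (ex_minnP ex) => p /asboolP wp pmin; exists p => s ws.
  by split=> //; apply: pmin; apply/asboolP.
(* For a word that does not occur in [x] the value is arbitrary. *)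
by exists 0 => s ws; case: nex; exists s; apply/asboolP.
Qed.

Lemma factorisation_blocks (X : Type) (x : infword X) u n0 :
  factorisation u (infsuffix x n0) ->
  exists P : nat -> nat, (forall k, P k < P k.+1) /\
    forall i j, i <= j ->
      flatten [seq u k | k <- iota i (j - i)] = factor x (P i) (P j - P i).
Proof.
move=> [u0 uE]; pose w k := flatten (mkseq u k).
have wS i j : i <= j -> w j = w i ++ flatten [seq u k | k <- iota i (j - i)].
  by move=> ij; rewrite -flatten_cat -map_cat -{2}[i]add0n -iotaD subnKC.
exists (fun k => n0 + size (w k)); split=> [k|i j ij].
  rewrite ltn_add2l (wS k k.+1) // subSnn /= cats0 size_cat -addn1 leq_add2l.
  by case: (u k) (u0 k).
have sij : size (w i) <= size (w j) by rewrite (wS _ _ ij) size_cat leq_addr.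
rewrite subnDl -[LHS](drop_size_cat _ (erefl (size (w i)))) -wS //.
have wj : w j = factor x n0 (size (w i) + (size (w j) - size (w i))).
  by rewrite subnKC //; exact: uE.
by rewrite [in LHS]wj factor_cat drop_size_cat // size_mkseq.
Qed.

Lemma gap_sorted i j k n : i <= j -> j <= k -> k <= n ->
  sorted ltn (iota i (j - i) ++ iota k (n - k)).
Proof.
move=> ij jk kn; apply: (subseq_sorted ltn_trans _ (iota_ltn_sorted i (n - i))).
have -> : n - i = (j - i) + ((k - j) + (n - k)) by lia.
rewrite iotaD subnKC // iotaD subnKC // cat_subseq //.
exact: suffix_subseq.
Qed.

(** * The two implications *)

Lemma flatten_nseq_sum (X : Type) (v : seq X) (a : nat -> nat) ks :
  flatten [seq flatten (nseq (a k) v) | k <- ks] =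
  flatten (nseq (\sum_(k <- ks) a k) v).
Proof.
elim: ks => [|k ks IH]; first by rewrite big_nil.
by rewrite big_cons nseqD flatten_cat /= IH.
Qed.

Lemma super_monochromatic_suffix (X : Type) (x : infword X) r (c : seq X -> 'I_r) :
  eventually_periodic x -> exists (n : nat) (u : nat -> seq X),
    factorisation u (infsuffix x n) /\ super_monochromatic c u.
Proof.
move=> [n [v [v0 vE]]].
have [a [i [a0 ai]]] := hindman (fun m => c (flatten (nseq m v))).
exists n, (fun k => flatten (nseq (a k) v)); split; last first.
  by exists i => ks ks0 sks; rewrite flatten_nseq_sum; exact: ai.
split=> [k|k /=].
  by case: (a k) (a0 k) => // m _ /=; case: (v) (v0 0).
have const m : mkseq (fun=> v) m = nseq m v.
  by rewrite /mkseq; elim: m 0 => //= m IH l; rewrite IH.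
by rewrite flatten_nseq_sum -const; exact: vE.
Qed.

Lemma no_super_monochromatic_suffix (X : Type) (x : infword X) :
  ~ eventually_periodic x -> exists c : seq X -> 'I_6,
    forall n u, factorisation u (infsuffix x n) -> ~ super_monochromatic c u.
Proof.
move=> nper; have [H Hsep] := suffix_separation nper.
have [p pP] := first_occurrence x.
(* This serves a word u_i ... u_(j-1) u_k ... u_(n-1) whose first occurrence [q] lies beyond the
   start of u_k. Its head is shorter than [q], so its tail is longer than [H q.*2], and both
   occurrences of the tail start at or before [q.*2]. *)
pose K q := H q.*2 + q.
pose ch w := changes (below (p w + size w) (p w)) (p w + size w).
pose c (w : seq X) : nat :=
  if `[< exists s, w = factor x s (size w) >] then
    if K (p w) < size w then (ch w %% 4).+1 else 5
  else 0.
have c6 w : c w < 6.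
  rewrite /c; case: asboolP => // _; case: ifP => // _.
  by apply: (@leq_ltn_trans 4); rewrite ?ltn_pmod.
have c_inv w w' s : w = factor x s (size w) -> K (p w) < size w -> c w' = c w ->
    [/\ exists s', w' = factor x s' (size w'), K (p w') < size w' &
     ch w' = ch w %[mod 4]].
  move=> ws Kw; rewrite /c [in RHS]asboolT; last by exists s.
  rewrite Kw; case: asboolP => // ex; case: ifP => [Kw' [chE]|_ E] //.
  by have := ltn_pmod (ch w) (isT : 0 < 4); rewrite -ltnS -E.
exists (fun w => Ordinal (c6 w)) => n0 u /factorisation_blocks[P [Plt blocks]] [a0 mono0].
pose a := nat_of_ord a0.
have mono ks : ks <> [::] -> sorted ltn ks -> c (flatten [seq u k | k <- ks]) = a.
  by move=> ks0 sks; rewrite /a -(mono0 ks ks0 sks).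
have Pge n := increasing_ge n Plt.
have Ple m n := @increasing_leq P m n Plt.
have far k L n : P k + L <= n -> k <= n /\ L <= P n - P k.
  by move=> h; have := Pge n; have := Pge k; clear -h; lia.
have mono_block k n : k < n -> c (factor x (P k) (P n - P k)) = a.
  move=> kn; rewrite -blocks 1?ltnW //; apply: mono; last exact: iota_ltn_sorted.
  by rewrite -(subnSK kn).
have mono_gap i j k n : i < j -> j < k -> k < n ->
    c (factor x (P i) (P j - P i) ++ factor x (P k) (P n - P k)) = a.
  move=> ij jk kn; rewrite -!blocks 1?ltnW // -flatten_cat -map_cat.
  apply: mono; last by apply: gap_sorted; exact: ltnW.
  by rewrite -(subnSK ij).
have block k n : P k + (K (P k)).+1 <= n -> let w := factor x (P k) (P n - P k) in
    [/\ k < n, p w = P k, size w = P n - P k & K (p w) < size w].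
  move=> /far[kn KL] w.
  have sw : size w = P n - P k by exact: size_mkseq.
  have [wp pk] : w = factor x (p w) (size w) /\ p w <= P k by apply: pP; rewrite sw.
  have pwE : p w = P k.
    apply: (Hsep (P k).*2 _ _ (P n - P k)); rewrite -?addnn ?leq_addr //.
    - exact: leq_trans pk (leq_addr _ _).
    - by rewrite addnn; apply: leq_trans KL; rewrite leqW // /K leq_addr.
    - by rewrite -sw -wp sw.
  split; rewrite ?pwE ?sw //; rewrite ltn_neqAle kn andbT; apply/eqP => nk.
  by move: KL; rewrite nk subnn.
(* One long block shows that the common colour is among 1, ..., 4; by [c_inv] every product then
   occurs in [x], is long, and has the same count modulo 4. *)
pose n1 := P 0 + (K (P 0)).+1.
have [k1 p1 s1 K1] := block 0 n1 (leqnn _).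
pose w1 := factor x (P 0) (P n1 - P 0).
have w1E : w1 = factor x (P 0) (size w1) by rewrite s1.
have c1 : c w1 = a := mono_block _ _ k1.
apply: (@no_monochromatic_alternating_sums P (ch w1) Plt) => [k|i j k ij jk].
  exists (P k + (K (P k)).+1) => n /block[kn pk sk Kk].
  have [|_ _] := c_inv _ (factor x (P k) (P n - P k)) _ w1E K1.
    by rewrite mono_block //; exact: esym c1.
  by rewrite /ch pk sk subnKC // Ple // ltnW.
exists (P k + (H (P k).*2 + (P k).*2 + (K (P k))).+1) => n nL.
have [|kn pk sk Kk] := block k n; first by clear -nL; lia.
have [_ nkL] := far _ _ _ nL.
set w := factor x (P i) (P j - P i) ++ factor x (P k) (P n - P k).
have [|[s ws] Kw] := c_inv _ w _ w1E K1; first by rewrite mono_gap //; exact: esym c1.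
have [wp _] := pP _ _ ws.
have Pij := Ple _ _ (ltnW ij); have Pjk := Ple _ _ (ltnW jk).
have Pkn := Ple _ _ (ltnW kn).
have sw : size w = (P j - P i) + (P n - P k) by rewrite size_cat !size_mkseq.
(* The tail occurs at [P k] and inside the first occurrence of [w]. It is long enough to force
   equality, by the choice of [n] if [p w <= P k] and by [K] otherwise. *)
have pE : p w + (P j - P i) = P k.
  pose Q := maxn (p w) (P k).
  have tailE : factor x (P k) (P n - P k) = factor x (p w + (P j - P i)) (P n - P k).
    have := congr1 (drop (P j - P i)) wp.
    by rewrite sw {1}/w factor_cat !drop_size_cat ?size_mkseq.
  apply/esym/(Hsep Q.*2); last exact: tailE.
  - by clear; lia.
  - by clear -Pij Pjk; lia.
  rewrite /Q; case: (leqP (p w) (P k)) => pwk.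
    by clear -nkL; lia.
  by move: Kw; rewrite /K sw; clear -Pij Pjk pwk; lia.
have -> : P k - P j + P i = p w by clear -pE Pij Pjk; lia.
by rewrite -(_ : p w + size w = P n) // sw addnA pE subnKC.
Qed.

Theorem theorem1 (X : Type) (x : infword X) :
  eventually_periodic x <->
  (forall (r : nat) (c : seq X -> 'I_r),
     exists (n : nat) (u : nat -> seq X),
       factorisation u (infsuffix x n) /\ super_monochromatic c u).
Proof.
split=> [per r c|mono]; first exact: super_monochromatic_suffix.
apply: contrapT => /no_super_monochromatic_suffix[c nc].
by have [n [u [fu su]]] := mono _ c; apply: nc fu su.
Qed.
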